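(* Given an integer $m \in \mathbb{N}$ there is an anabelian group $G$ with $G = G^{30}$ and an element $g \in G$ which is not a product of less than $m$ $30$-th powers of elements of $G$.
   Context: A finite group is called anabelian if none of its composition factors is abelian (anabelian groups are finite by definition). For a group $G$, $G^{30}$ denotes the subgroup of $G$ generated by all elements $x^{30}$ with $x \in G$. *)

(* Defs.v *)
From mathcomp Require Import all_boot all_fingroup all_solvable.

Set Implicit Arguments.
Unset Strict Implicit.
Unset Printing Implicit Defensive.

Local Open Scope group_scope.

(* A section Q = (H / K)%sec of gT coerces to the quotient group H / K.
   If s = [:: G1; ...; Gk] satisfies comps G s, i.e. G > G1 > ... > Gk = 1 is a
   composition series, then pairmap (@mkSec gT) G s lists its factors
   G / G1, G1 / G2, ..., G(k-1) / Gk. *)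
Definition composition_factor (gT : finGroupType) (G : {group gT})
    (Q : section gT) : Prop :=
  exists2 s : seq {group gT}, comps G s & Q \in pairmap (@mkSec gT) G s.

Definition anabelian (gT : finGroupType) (G : {group gT}) : Prop :=
  forall Q : section gT, composition_factor G Q -> ~~ abelian Q.

Definition power_subgroup (gT : finGroupType) (n : nat) (G : {group gT}) :
    {set gT} :=
  <<[set x ^+ n | x in G]>>.

(* Main.v *)
(* Let S be a nonabelian simple group with S^30 = S, such as Alt(7), and take the
   power H = S^I with |I| > |S|^m: for fewer than m elements of H, two of the
   coordinates i, j agree on all of them.  Let H act on the disjoint union W,
   over i != j, of copies of S by u |-> (h_i)^-1 u h_j; then any fewer than m
   elements of H have a common fixed point, although H fixes no point.  In the
   wreath product G of Alt(5) with H acting on W, the 30th power of an element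
   whose H-part fixes x has a trivial coordinate at x because Alt(5) has exponent
   30.  So a product of fewer than m 30th powers has a trivial coordinate, and a
   base element with no trivial coordinate is not such a product.  Finally G^30
   contains H and, as H moves every point of W, the perfect base group too. *)
From HB Require Import structures.
Require Import Defs.
From mathcomp Require Import all_boot all_fingroup all_solvable.

Set Implicit Arguments.
Unset Strict Implicit.
Unset Printing Implicit Defensive.

Local Open Scope group_scope.

(** * Groups whose subnormal subgroups are all perfect *)

Section SubnormallyPerfect.

Implicit Types gT rT : finGroupType.

(** A substitute for [anabelian] that mentions no composition series, so that it passes through
    extensions by a direct argument. *)
Definition subnormally_perfect gT (G : {group gT}) : Prop :=
  forall K : {group gT}, K <|<| G -> K \subset K^`(1).

(** An abelian top factor [G / H] would give [G = G' <= H], against the properness of [H]. The other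
    factors are handled by induction, since subnormal subgroups of [H] are subnormal in [G]. *)
Lemma subnormally_perfect_anabelian gT (G : {group gT}) :
  subnormally_perfect G -> anabelian G.
Proof.
move=> perfG Q [s /compsP[_]]; elim: s G perfG => [//|H s IHs] G perfG /=.
case/andP=> /maxgroupp/andP[/andP[sHG nsGH] nHG] Hs; rewrite inE.
have nsHG : H <| G by rewrite /normal sHG.
case/predU1P=> [->|Qs] /=; last first.
  apply: IHs Hs Qs => K snKH; apply: perfG.
  exact: subnormal_trans snKH (normal_subnormal nsHG).
apply: contra nsGH => /(der1_min nHG).
exact: subset_trans (perfG G (subnormal_refl G)).
Qed.

Lemma subnormally_perfect_trivial gT : subnormally_perfect (1%G : {group gT}).
Proof. by move=> K /subnormal_sub sK1; apply: subset_trans sK1 (sub1G _). Qed.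

(** As [f @* K] is perfect, every [x] in [K] is [a * b] with [a] in the kernel and [b] in [K']. Then
    [a] lies in the part of [K] inside the kernel, which is subnormal there, hence perfect, hence
    inside [K']. *)
Lemma subnormally_perfect_ext gT rT (D G : {group gT}) (f : {morphism D >-> rT}) :
    G \subset D -> subnormally_perfect ('ker_G f)%G ->
  subnormally_perfect (f @* G)%G -> subnormally_perfect G.
Proof.
move=> sGD perfN perfQ K snKG.
have sKG := subnormal_sub snKG; have sKD := subset_trans sKG sGD.
have /perfQ : f @* K <|<| f @* G by apply: morphim_subnormal.
rewrite -morphim_der // morphimSK // => sK.
have := perfN _ (setI_subnormal (subsetIl G ('ker f)) snKG) => /= perfI.
apply/subsetP=> x Kx; have /mulsgP[a b kera K'b defx] := subsetP sK x Kx.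
have Kb := subsetP (der_sub 1 K) b K'b.
have Ka : a \in K by rewrite -(mulgK b a) -defx groupM ?groupV.
rewrite defx groupM // (subsetP (dergS 1 (subsetIl K ('ker_G f)))) //.
by rewrite (subsetP perfI) // inE Ka inE (subsetP sKG).
Qed.

Lemma subnormally_perfect_isog gT rT (G : {group gT}) (H : {group rT}) :
  G \isog H -> subnormally_perfect G -> subnormally_perfect H.
Proof.
rewrite isog_sym => /isogP[f injf fH] perfG.
apply: (@subnormally_perfect_ext _ _ _ _ f) => //.
  have -> : ('ker_H f = 1)%G by apply/val_inj; rewrite /= (trivgP injf) setIg1.
  exact: subnormally_perfect_trivial.
by have -> : (f @* H = G)%G by apply/val_inj.
Qed.

Lemma simple_subnormally_perfect gT (G : {group gT}) :
  simple G -> ~~ abelian G -> subnormally_perfect G.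
Proof.
case/simpleP=> _ simG nabG K /subnormalEr[->|[L [snKL nsLG ltLG]]].
  have [/derG1P abG|-> //] := simG _ (der_normal 1 G).
  by rewrite abG in nabG.
have [L1|LG] := simG _ nsLG; last by rewrite LG properxx in ltLG.
by rewrite (subset_trans (subnormal_sub snKL)) // L1 sub1G.
Qed.

Lemma subnormally_perfect_setXn (I : finType) (gT : I -> finGroupType)
    (H : forall i, {group gT i}) :
  (forall i, subnormally_perfect (H i)) -> subnormally_perfect (setXn_group H).
Proof.
(* Letting the support [A] vary, with trivial factors outside it, keeps the induction inside one
   product type. *)
move=> perfH; pose HA (A : {set I}) i := if i \in A then H i else 1%G.
suff perfA A : subnormally_perfect (setXn_group (HA A)).
  have -> : setXn_group H = setXn_group (HA setT).
    apply/val_inj/setP => x.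
    by apply/setXnP/setXnP => xH i; have := xH i; rewrite /HA in_setT.
  exact: perfA.
have [n] := ubnP #|A|; elim: n A => // n IHn A; rewrite ltnS => leAn.
have [->|[a Aa]] := set_0Vmem A.
  have -> : (setXn_group (HA set0) = 1)%G.
    apply/val_inj/trivgP/subsetP => x /setXnP xH; apply/set1P/ffunP => i.
    by have := xH i; rewrite /HA inE => /set1P->; rewrite ffunE.
  exact: subnormally_perfect_trivial.
(* Projection to coordinate [a] has image [H a], and its kernel is the product supported on
   [A :\ a]. *)
apply: (@subnormally_perfect_ext _ _ _ (setXn_group (HA A))
                                 (dffun_morphism gT a)).
  exact: subsetT.
  have -> : ('ker_(setXn_group (HA A)) (dffun_morphism gT a)
             = setXn_group (HA (A :\ a)))%G.
    apply/val_inj/setP => x; rewrite in_setI; apply/andP/setXnP => /=.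
      case=> /setXnP xH; rewrite !inE /= => /eqP xa i.
      rewrite /HA !inE; have [->|_] /= := eqVneq i a; first by rewrite xa.
      exact: xH.
    move=> xH; split.
      apply/setXnP => i; have := xH i; rewrite /HA !inE.
      by case: eqP => [->|_] //= /set1P->.
    by have := xH a; rewrite /HA setD11 => /set1P xa; rewrite !inE /= xa.
  apply: IHn; rewrite (leq_trans _ leAn) // [X in _ < X](cardsD1 a) Aa.
  exact: leqnn.
have -> : (dffun_morphism gT a @* setXn_group (HA A) = H a)%G.
  by apply/val_inj; rewrite /= morphim_dffunXn /HA Aa.
exact: perfH.
Qed.

End SubnormallyPerfect.

Lemma setXnT (I : finType) (gT : I -> finGroupType) :
  setXn (fun i => [set: gT i]) = [set: {dffun forall i, gT i}].
Proof. by apply/setP=> f; rewrite [RHS]inE; apply/setXnP=> i; rewrite inE. Qed.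

(** * The subgroup generated by the [n]-th powers *)

Section PowerSubgroup.

Lemma mem_power_subgroup (gT : finGroupType) n (G : {group gT}) x :
  x \in G -> x ^+ n \in power_subgroup n G.
Proof. by move=> Gx; apply/mem_gen/(imset_f (fun z => z ^+ n)). Qed.

Lemma power_subgroup_normal (gT : finGroupType) n (G : {group gT}) :
  power_subgroup n G <| G.
Proof.
rewrite /normal gen_subG; apply/andP; split.
  by apply/subsetP=> _ /imsetP[x Gx ->]; rewrite groupX.
apply: norms_gen; apply/subsetP => y Gy; rewrite inE.
apply/subsetP=> _ /imsetP[_ /imsetP[x Gx ->] ->].
by rewrite conjXg (imset_f (fun z => z ^+ n)) ?groupJ.
Qed.

Lemma morphim_power_subgroupT (aT rT : finGroupType) n
    (f : {morphism [set: aT] >-> rT}) c :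
  power_subgroup n [set: aT] = [set: aT] -> f c \in power_subgroup n [set: rT].
Proof.
move=> powA; have : c \in power_subgroup n [set: aT] by rewrite powA inE.
suff /subsetP sub :
    power_subgroup n [set: aT] \subset f @*^-1 power_subgroup n [set: rT].
  by move/sub; rewrite !inE.
rewrite gen_subG; apply/subsetP=> _ /imsetP[x _ ->].
by rewrite !inE /= morphX ?inE // mem_power_subgroup ?inE.
Qed.

Lemma simple_power_subgroup (gT : finGroupType) n (G : {group gT}) x :
  simple G -> x \in G -> x ^+ n != 1 -> power_subgroup n G = G.
Proof.
case/simpleP=> _ simG Gx /eqP xn1.
have [P1|//] := simG _ (power_subgroup_normal n G).
by have := mem_power_subgroup n Gx; rewrite [power_subgroup _ _]P1 => /set1P.
Qed.

End PowerSubgroup.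

(* The action is a phantom parameter: it selects the group law. *)
Definition wreath_of (aT hT : finGroupType) (W : finType)
  of {action hT &-> W} : Type := ({dffun W -> aT} * hT)%type.

(** * Permutational wreath products *)

Section Wreath.

Variables (aT hT : finGroupType) (W : finType) (to : {action hT &-> W}).

Local Notation wreath := (wreath_of aT to).

HB.instance Definition _ := Finite.on wreath.

Definition wreath_one : wreath := (1, 1).
Definition wreath_mul (w v : wreath) : wreath :=
  ([ffun x => w.1 x * v.1 (to x w.2)], w.2 * v.2).
Definition wreath_inv (w : wreath) : wreath :=
  ([ffun x => (w.1 (to x w.2^-1))^-1], w.2^-1).

Lemma wreath_mul1g : left_id wreath_one wreath_mul.
Proof.
case=> f h; congr (_, _); rewrite ?mul1g //=.
by apply/ffunP=> x; rewrite !ffunE /= act1 mul1g.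
Qed.

Lemma wreath_mulVg : left_inverse wreath_one wreath_inv wreath_mul.
Proof.
case=> f h; congr (_, _); rewrite /= ?mulVg //.
by apply/ffunP=> x; rewrite !ffunE /= mulVg.
Qed.

Lemma wreath_mulA : associative wreath_mul.
Proof.
move=> [f h] [f' h'] [f'' h'']; congr (_, _); rewrite /= ?mulgA //.
by apply/ffunP=> x; rewrite !ffunE /= actM mulgA.
Qed.

HB.instance Definition _ :=
  Finite_isGroup.Build wreath wreath_mulA wreath_mul1g wreath_mulVg.

Lemma wreath_base1E x : (1 : wreath).1 x = 1.
Proof. exact: oneg_ffun. Qed.

Lemma wreath_baseME (w v : wreath) x : (w * v).1 x = w.1 x * v.1 (to x w.2).
Proof. by rewrite ffunE. Qed.

Lemma wreath_baseVE (w : wreath) x : w^-1.1 x = (w.1 (to x w.2^-1))^-1.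
Proof. by rewrite ffunE. Qed.

Lemma wreath_ext (w v : wreath) : w.1 =1 v.1 -> w.2 = v.2 -> w = v.
Proof. by case: w v => f h [g k] /= /ffunP-> ->. Qed.

Definition wreath_top (w : wreath) : hT := w.2.

Lemma wreath_topM : {morph wreath_top : w v / w * v}.
Proof. by []. Qed.

Canonical wreath_top_morphism := @Morphism _ _ setT _ (in2W wreath_topM).

Definition wreath_inl (f : {dffun W -> aT}) : wreath := (f, 1).

Lemma wreath_inlM : {morph wreath_inl : f g / f * g}.
Proof.
move=> f g; apply: wreath_ext => [x|]; last by rewrite /= mulg1.
by rewrite wreath_baseME mulg_ffun /= act1.
Qed.

Canonical wreath_inl_morphism := @Morphism _ _ setT _ (in2W wreath_inlM).

Definition wreath_inr (h : hT) : wreath := (1, h).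

Lemma wreath_inrM : {morph wreath_inr : h k / h * k}.
Proof.
move=> h k; apply: wreath_ext => [x|//].
by rewrite wreath_baseME !oneg_ffun mulg1.
Qed.

Canonical wreath_inr_morphism := @Morphism _ _ setT _ (in2W wreath_inrM).

Lemma injm_wreath_inl : 'injm wreath_inl.
Proof. by apply/injmP=> f g _ _ []. Qed.

Lemma wreath_splitE (w : wreath) : w = wreath_inl w.1 * wreath_inr w.2.
Proof.
by apply: wreath_ext => [x|]; rewrite ?wreath_baseME /= ?oneg_ffun ?mulg1 ?mul1g.
Qed.

Lemma ker_wreath_top : 'ker wreath_top = wreath_inl @* setT.
Proof.
apply/setP=> w; rewrite !inE /=; apply/eqP/morphimP=> [w1|[f _ _ ->] //].
by exists w.1; rewrite ?inE //; case: w w1 => f h /= ->.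
Qed.

Lemma wreath_subnormally_perfect :
    subnormally_perfect [set: aT]%G -> subnormally_perfect [set: hT]%G ->
  subnormally_perfect [set: wreath]%G.
Proof.
move=> perfA perfH.
apply: (@subnormally_perfect_ext _ _ _ _ wreath_top_morphism) => //.
  have perfB := @subnormally_perfect_setXn W (fun=> aT) _ (fun=> perfA).
  apply: subnormally_perfect_isog perfB.
  rewrite /= setTI ker_wreath_top.
  by rewrite setXnT sub_isog // injm_wreath_inl.
have -> // : (wreath_top @* [set: wreath] = [set: hT])%G.
apply/val_inj/setP=> h; rewrite inE; apply/morphimP.
by exists (wreath_inr h); rewrite ?inE.
Qed.

(** Reading the base coordinate at [x] is multiplicative on the elements whose top part fixes
    [x]. *)
Lemma wreath_power_fix (w : wreath) n x :
  to x w.2 = x -> (w ^+ n).1 x = w.1 x ^+ n.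
Proof.
move=> fix_x; elim: n => [|n IHn]; first by rewrite !expg0 wreath_base1E.
by rewrite !expgS wreath_baseME fix_x IHn.
Qed.

Lemma wreath_power_topE (w : wreath) n : (w ^+ n).2 = w.2 ^+ n.
Proof. by elim: n => // n IHn; rewrite !expgS /= IHn. Qed.

Lemma wreath_prod_power_fix (s : seq wreath) n x :
    (forall w, w \in s -> to x w.2 = x) ->
  (\prod_(w <- s) w ^+ n).1 x = \prod_(w <- s) w.1 x ^+ n.
Proof.
elim: s => [|w s IHs] fixs; first by rewrite !big_nil wreath_base1E.
have fixw : to x w.2 = x by rewrite fixs ?mem_head.
rewrite !big_cons wreath_baseME wreath_power_fix // wreath_power_topE.
have -> : to x (w.2 ^+ n) = x.
  by elim: (n) => [|k IHk]; rewrite ?act1 // expgSr actM IHk.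
by rewrite IHs // => v sv; rewrite fixs // inE sv orbT.
Qed.

Lemma wreath_inl_conj f h :
  wreath_inl f ^ wreath_inr h = wreath_inl [ffun x => f (to x h^-1)].
Proof.
rewrite conjgE; apply: wreath_ext => [x|]; last by rewrite /= mul1g mulVg.
by rewrite !wreath_baseME wreath_baseVE /= !oneg_ffun invg1 mul1g mulg1 ffunE.
Qed.

(* With [d a] the function equal to [a] at [x] and trivial elsewhere, and [h]
   moving [x], the commutator of [d a^-1] with [h] lies in [N] and has value
   [a] at [x]; its commutator with [d b] is exactly [d [~ a, b]]. *)
Lemma wreath_normal_full (N : {group wreath}) :
    N <| [set: wreath] -> (forall h, wreath_inr h \in N) ->
    (forall x, exists h, to x h != x) ->
    [set: aT] \subset [set: aT]^`(1) ->
  N :=: [set: wreath].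
Proof.
move=> /andP[_ nNW] topN moved perfA; apply/eqP; rewrite eqEsubset subsetT /=.
have NR u v : u \in N -> [~ u, v] \in N.
  by move=> Nu; rewrite groupM ?groupV // memJ_norm // (subsetP nNW) ?inE.
suff inlN f : wreath_inl f \in N.
  by apply/subsetP=> w _; rewrite [w]wreath_splitE groupM.
have : f \in setXn (fun=> [set: aT]%G) by rewrite setXnT inE.
rewrite -setXn_prod => /prodsgP[F FP ->].
rewrite (big_morph wreath_inl wreath_inlM (erefl _)); apply: group_prod => x _.
have /set1gXnP[c _ ->] := FP x isT; move: c.
pose d : aT -> {dffun W -> aT} := @dfung1 W (fun=> aT) x.
(* The preimage of [N] in [aT] is a subgroup, so by perfectness of [aT] it is enough that it
   contains all commutators. *)
suff /subsetP sub : [set: aT] \subset d @*^-1 (wreath_inl @*^-1 N).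
  by move=> c; have := sub c; rewrite !inE => /(_ isT).
apply: subset_trans perfA _; rewrite gen_subG.
apply/subsetP=> _ /imset2P[a b _ _ ->].
suff : wreath_inl (d [~ a, b]) \in N by rewrite !inE.
have [h hx] := moved x.
have hVx : to x h^-1 != x by apply: contra hx => /eqP {1}<-; rewrite actKV.
pose f' : {dffun W -> aT} := (d a^-1)^-1 * [ffun y => d a^-1 (to y h^-1)].
have Nf' : wreath_inl f' \in N.
  rewrite wreath_inlM morphV ?inE //= -wreath_inl_conj.
  by rewrite -[_ * _]/[~ _, _] -groupV invg_comm NR.
have -> : d [~ a, b] = [~ f', d b].
  apply/ffunP=> y.
  have /= -> :=
    morphR (dffun_morphism (fun=> aT) y) (in_setT f') (in_setT (d b)).
  rewrite mulg_ffun invg_ffun [[ffun _ => _] _]ffunE.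
  have [->|] := eqVneq y x; last first.
    by rewrite eq_sym /d => neq_xy; rewrite !(dfung1_dflt _ neq_xy) commg1.
  by rewrite /d !dfung1_id invgK dfung1_dflt ?mulg1 // eq_sym.
by rewrite morphR ?inE // NR.
Qed.

End Wreath.

Lemma power_subgroup_dffun (I : finType) (gT : I -> finGroupType) n :
    (forall i, power_subgroup n [set: gT i] = [set: gT i]) ->
  power_subgroup n [set: {dffun forall i, gT i}] = [set: {dffun forall i, gT i}].
Proof.
move=> pow; apply/eqP; rewrite eqEsubset subsetT /=.
apply/subsetP=> f _.
have : f \in setXn (fun i => [set: gT i]%G) by rewrite setXnT inE.
rewrite -setXn_prod => /prodsgP[F FP ->].
apply: group_prod => i _; have /set1gXnP[c _ ->] := FP i isT.
exact: (morphim_power_subgroupT (dfung1_morphism gT i)).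
Qed.

(** * An action without global fixed points in which few elements share a fixed point *)

Section TwistedAction.

Variables (I : finType) (gT : finGroupType).

(* Two distinct coordinates of [{dffun I -> gT}] act on [gT] by multiplication
   on the left and on the right: the fixator of [1] is where they agree. *)
Definition twisted_point : finType := ({p : I * I | p.1 != p.2} * gT)%type.

Definition twisted_act (x : twisted_point) (h : {dffun I -> gT}) :
    twisted_point :=
  (x.1, (h (val x.1).1)^-1 * x.2 * h (val x.1).2).

Lemma twisted_act1 x : twisted_act x 1 = x.
Proof. by case: x => p u; rewrite /twisted_act !oneg_ffun invg1 mul1g mulg1. Qed.

Lemma twisted_actM x : act_morph twisted_act x.
Proof. by move=> h k; rewrite /twisted_act !mulg_ffun invMg /= !mulgA. Qed.

Definition twisted_action := TotalAction twisted_act1 twisted_actM.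

Lemma twisted_action_moved x (v : gT) :
  v != 1 -> exists h, twisted_action x h != x.
Proof.
(* This [h] is [v] at the first coordinate of the pair and trivial at the second, which is
   different; it sends [u] to [v^-1 * u]. *)
case: x => p u nv1; exists (dfung1 (v : (fun=> gT) (val p).1)).
apply: contra nv1 => /eqP[/eqP].
rewrite dfung1_id (dfung1_dflt _ (valP p)) mulg1 -{2}[u]mul1g.
by rewrite (inj_eq (mulIg u)) invg_eq1.
Qed.

Lemma twisted_action_fix p (h : {dffun I -> gT}) :
  h (val p).1 = h (val p).2 -> twisted_action (p, 1) h = (p, 1).
Proof. by rewrite /= /twisted_act /= => ->; rewrite mulg1 mulVg. Qed.

End TwistedAction.

Lemma common_coordinates (I : finType) (gT : finGroupType) m
    (s : seq {dffun I -> gT}) :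
    size s <= m -> #|gT| ^ m < #|I| ->
  exists2 p : I * I, p.1 != p.2 & forall h, h \in s -> h p.1 = h p.2.
Proof.
move=> les ltI.
(* Pigeonhole: [f i] records the values at [i] of the members of [s], padded with 1 up to length
   [m]. *)
pose f i := [ffun k : 'I_m => (nth 1 s k : {dffun I -> gT}) i].
have /injectivePn[i [j neq_ij eq_f]] : ~~ injectiveb f.
  apply: contraL ltI => /injectiveP/leq_card; rewrite card_ffun card_ord.
  by rewrite leqNgt.
exists (i, j) => // h sh.
have ltk : index h s < m by rewrite (leq_trans _ les) ?index_mem.
by have /ffunP/(_ (Ordinal ltk)) := eq_f; rewrite !ffunE /= nth_index.
Qed.

(** Isolates what is used of Alt(5), as [aT], and of Alt(7), as [sT], when [n] is 30. *)
Theorem power_width_unbounded (aT sT : finGroupType) n m :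
    simple [set: aT] -> ~~ abelian [set: aT] -> (forall a : aT, a ^+ n = 1) ->
    simple [set: sT] -> ~~ abelian [set: sT] -> (exists u : sT, u ^+ n != 1) ->
  exists (gT : finGroupType) (G : {group gT}) (g : gT),
    [/\ anabelian G,
        G :=: power_subgroup n G,
        g \in G
      & forall s : seq gT, {subset s <= G} -> size s < m ->
          g <> \prod_(x <- s) x ^+ n].
Proof.
move=> simA nabA expA simS nabS [u un1].
have perfA : subnormally_perfect [set: aT]%G by apply: simple_subnormally_perfect.
have perfS : subnormally_perfect [set: sT]%G by apply: simple_subnormally_perfect.
(* The successor makes the number of coordinates exceed the number of [m]-tuples over [sT]. *)
pose I : finType := 'I_(#|sT| ^ m).+1.
pose W := wreath_of aT (twisted_action I sT).
have nontriv (gT : finGroupType) :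
    simple [set: gT] -> exists2 c : gT, c \in [set: gT] & c != 1.
  by case/simpleP=> ntG _; apply/trivgPn.
have [[a _ na1] [v _ nv1]] := (nontriv _ simA, nontriv _ simS).
exists W, [set: W]%G, (wreath_inl _ [ffun=> a]); split; rewrite ?inE //.
- apply/subnormally_perfect_anabelian/wreath_subnormally_perfect => //.
  have := @subnormally_perfect_setXn I (fun=> sT) _ (fun=> perfS).
  by congr subnormally_perfect; apply/val_inj/setXnT.
- apply/esym/wreath_normal_full; first exact: power_subgroup_normal.
  + move=> h; have powS : power_subgroup n [set: sT] = [set: sT].
      exact: simple_power_subgroup un1.
    have powH := @power_subgroup_dffun I (fun=> sT) n (fun=> powS).
    exact: (morphim_power_subgroupT (wreath_inr_morphism aT _)).
  + by move=> x; apply: twisted_action_moved nv1.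
  + exact/perfA/subnormal_refl.
move=> s _ lts eqg.
have [||p neq_p fix_p] := @common_coordinates I sT m [seq w.2 | w : W <- s].
- by rewrite size_map ltnW.
- by rewrite card_ord.
(* At the common fixed point the product becomes a product of [n]-th powers in [aT], hence 1,
   whereas [g] takes the value [a] there. *)
have := congr1 (fun w : W => w.1 (exist _ p neq_p, 1)) eqg.
rewrite wreath_prod_power_fix => [|w sw].
  by rewrite ffunE big1 // => /eqP; rewrite (negPf na1).
by apply/twisted_action_fix/fix_p/map_f.
Qed.

(** * The 30th powers in Alt(5) and Alt(7) *)

(** Cycle lengths are at most 5. A cycle of length 4 leaves one fixed point, so the permutation has
    two orbits on five points and is odd. The remaining lengths 1, 2, 3 and 5 divide 30. *)
Lemma Alt5_expg30 (x : {perm 'I_5}) : x \in 'Alt_('I_5) -> x ^+ 30 = 1.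
Proof.
rewrite Alt_even => evx; apply/permP => i; rewrite perm1 permX.
have iterK k : #|porbit x i| %| k -> iter k x i = i.
  case/dvdnP=> q ->; elim: q => // q IHq.
  by rewrite mulSn iterD IHq iter_porbit.
have le5 : #|porbit x i| <= 5 by have := max_card (porbit x i); rewrite card_ord.
have card_neq4 : #|porbit x i| != 4.
  apply: contraNneq evx => card4.
  have /cards1P[j defC] : #|~: porbit x i| == 1%N.
    by rewrite -(eqn_add2l #|porbit x i|) cardsC card_ord card4.
  have notOj : j \notin porbit x i by rewrite -in_setC defC set11.
  suff defP : porbits x = [set porbit x i; porbit x j].
    by rewrite /odd_perm card_ord defP cards2 eq_porbit_mem porbit_sym notOj.
  apply/setP=> O; rewrite !inE; apply/imsetP/orP => [[y _ ->]|].
    have [Oy|] := boolP (y \in porbit x i); first by left; rewrite eq_porbit_mem.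
    by rewrite -in_setC defC => /set1P->; right.
  by case=> /eqP->; [exists i | exists j].
case: #|_| (card_porbit_neq0 x i) le5 card_neq4 iterK => [|[|[|[|[|[|]]]]]] //.
all: by move=> _ _ _; apply.
Qed.

(** An element of order 7 works, as 7 does not divide 30. *)
Lemma Alt7_expg30 : exists2 x : {perm 'I_7}, x \in 'Alt_('I_7) & x ^+ 30 != 1.
Proof.
have dvd7 : 7 %| #|'Alt_('I_7)|.
  have : 7 %| 2 * #|'Alt_('I_7)| by rewrite card_Alt card_ord // dvdn_fact.
  by rewrite Gauss_dvdr.
have [x Ax ox] := Cauchy (isT : prime 7) dvd7.
by exists x => //; rewrite -order_dvdn ox.
Qed.

Lemma simple_subg (gT : finGroupType) (G : {group gT}) :
  simple G -> simple [set: subg_of G].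
Proof. by rewrite (isog_simple (isog_subg G)). Qed.

Lemma abelian_subg (gT : finGroupType) (G : {group gT}) :
  abelian [set: subg_of G] = abelian G.
Proof. by rewrite (isog_abelian (isog_subg G)). Qed.

Lemma Alt_nonabelian n : 4 < n -> ~~ abelian 'Alt_('I_n).
Proof.
move=> gt4; apply/negP => /abelian_sol.
by rewrite solvable_AltF ?card_ord.
Qed.

Theorem theorem4 (m : nat) :
  exists (gT : finGroupType) (G : {group gT}) (g : gT),
    [/\ anabelian G,
        G :=: power_subgroup 30 G,
        g \in G
      & forall s : seq gT, {subset s <= G} -> size s < m ->
          g <> \prod_(x <- s) x ^+ 30].
Proof.
(* The general theorem concerns full group types, so each alternating group is made into a type by
   [subg_of]. *)
apply: (@power_width_unbounded (subg_of 'Alt_('I_5)) (subg_of 'Alt_('I_7))).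
- by apply/simple_subg/simple_Alt5; rewrite card_ord.
- by rewrite abelian_subg Alt_nonabelian.
- move=> a; apply: subg_inj.
  by rewrite (morphX (sgval_morphism _)) ?inE // Alt5_expg30 ?subgP.
- by apply/simple_subg/simple_Alt5; rewrite card_ord.
- by rewrite abelian_subg Alt_nonabelian.
have [x Ax xn1] := Alt7_expg30; exists (Subg Ax).
apply: contra xn1 => /eqP/(congr1 sgval).
by rewrite (morphX (sgval_morphism _)) ?inE //= => ->.
Qed.
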